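(* Let $A,B\in\mathbb{C}^{N\times N}$ be commuting matrices such that $A+sI$ and $B+sI$ are invertible for every integer $s\ge0$. Then for every integer $n\ge0$, $$\Big[n(A+nI)(B+nI)+\left((3n^2-3n+1)I+(2n-1)(A+B)+AB-zI\right)(\theta-n)+\left(A+B+(3n-3)I\right)(\theta-n)_2+(\theta-n)_3I\Big]\mathbf{B}_n^{A,B}(z)=\mathbf{0},$$ where $\theta=z\frac{d}{dz}$.
   Context: $I$ is the $N\times N$ identity matrix, $\mathbf 0$ the zero matrix; for $M\in\mathbb{C}^{N\times N}$, $(M)_0=I$ and $(M)_k=M(M+I)\cdots(M+(k-1)I)$ for $k\ge1$. For the differential operator $\theta=z\frac{d}{dz}$, $(\theta-n)_k=(\theta-n)(\theta-n+1)\cdots(\theta-n+k-1)$; coefficients (including $z$) standing to the left of an operator multiply after the operator is applied. The Bateman matrix polynomials are $$\mathbf{B}_n^{A,B}(z)=\sum_{k=0}^{n}\frac{(-1)^k n!\,z^k}{k!\,(n-k)!}[(A+I)_k]^{-1}[(B+I)_k]^{-1}.$$ *)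

(* Defs.v *)
From mathcomp Require Import all_boot all_order all_algebra.
From mathcomp Require Import boolp classical_sets reals topology normedtype derive.
From mathcomp Require Import complex.

Set Implicit Arguments.
Unset Strict Implicit.
Unset Printing Implicit Defensive.

Import GRing.Theory Num.Theory numFieldNormedType.Exports.

Local Open Scope ring_scope.

Definition mx_poch (K : fieldType) (N : nat) (M : 'M[K]_N) (k : nat) : 'M[K]_N :=
  \prod_(j < k) (M + j%:R%:M).

Definition bateman (K : fieldType) (N : nat) (A B : 'M[K]_N) (n : nat) (z : K) :
    'M[K]_N :=
  \sum_(k < n.+1)
    ((-1) ^+ k * n`!%:R * z ^+ k / (k`!%:R * (n - k)`!%:R)) *:
      (invmx (mx_poch (A + 1%:M) k) *m invmx (mx_poch (B + 1%:M) k)).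

(* The derivative is the limit of difference quotients over the field K itself,
   so it is the complex derivative when K is R[i]. *)
Definition theta (K : numFieldType) (N : nat) (f : K -> 'M[K]_N) : K -> 'M[K]_N :=
  fun z => z *: derive1 f z.

Definition theta_shift (K : numFieldType) (N : nat) (c : K) (f : K -> 'M[K]_N) :
    K -> 'M[K]_N :=
  fun z => theta f z + c *: f z.

(* The composite (theta + c) (theta + c + 1) ... (theta + c + k - 1): the
   factor with the largest shift is applied to f first. *)
Fixpoint theta_poch (K : numFieldType) (N : nat) (c : K) (k : nat)
    (f : K -> 'M[K]_N) : K -> 'M[K]_N :=
  if k is k'.+1 then theta_poch c k' (theta_shift (c + k'%:R) f) else f.

(* Main.v *)
Require Import Defs.
From mathcomp Require Import all_boot all_order all_algebra.
From mathcomp Require Import ring.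
From mathcomp Require Import functions.
From mathcomp Require Import boolp classical_sets reals topology normedtype derive.
From mathcomp Require Import complex.

Import GRing.Theory Num.Theory numFieldNormedType.Exports.

Local Open Scope ring_scope.

(** In terms of [theta], the operator of the theorem is the hypergeometric
operator [theta (theta + A) (theta + B) - z (theta - n)] of a 1F2 series with
numerator parameter [-n] and denominator parameters [A + 1], [B + 1]: the two
agree as polynomials in [theta - n] ([shifted_symbolE]), because the polynomial
[(x + n) (x + n + A) (x + n + B)] expands in the rising factorials of [x] with
exactly the coefficients of the theorem.

On polynomials in [z] with matrix coefficients, [theta] acts diagonally: it
multiplies the term of degree [k] by [k] ([theta_poch_mxsum]).  So the first
part of the operator multiplies the term of degree [k] by
[k (A + k) (B + k)], which vanishes for [k = 0], and the part [z (theta - n)]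
multiplies it by [z (k - n)], which vanishes for [k = n].  What is left cancels
degree by degree through the two-term recurrence
[(k + 1) (A + k + 1) (B + k + 1) c_(k+1) = (k - n) c_k] satisfied by the
coefficients of the Bateman polynomial ([bateman_coef_rec]).  Commutation of
[A] and [B] is used there, to bring [B + k + 1] next to its inverse. *)

Section EulerOperator.
Variables (K : numFieldType) (N : nat).
Implicit Types (C : nat -> 'M[K]_N) (c z : K).

(** Polynomials with matrix coefficients, as functions of the variable; the
coefficients are indexed by all of [nat] so that [theta] acts by rescaling
them. *)
Definition mxsum (m : nat) C (z : K) : 'M[K]_N := \sum_(k < m) z ^+ k *: C k.

Lemma is_derive_mxmonomial k (M : 'M[K]_N) z :
  is_derive z 1 (fun y : K => y ^+ k *: M) ((k%:R * z ^+ k.-1) *: M).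
Proof.
have dX : differentiable (fun y : K => y ^+ k) z.
  by apply/derivable1_diffP; apply: exprn_derivable.
split; first by apply/derivable1_diffP; apply: differentiableZl.
rewrite deriveE; last exact: differentiableZl.
by rewrite diffZl // -deriveE // exp_derive scaler1.
Qed.

Lemma theta_mxsum m C z :
  theta (mxsum m C) z = mxsum m (fun k => k%:R *: C k) z.
Proof.
rewrite /theta derive1E.
have -> : mxsum m C =
    \sum_(k < m) ((fun y => y ^+ k *: C k) : K -> 'M[K]_N).
  by apply/funext => y; rewrite fct_sumE.
rewrite (@derive_val _ _ _ _ _ _ _ (is_derive_sum
  (fun k : 'I_m => is_derive_mxmonomial k (C k) z))).
rewrite scaler_sumr; apply: eq_bigr => k _; rewrite !scalerA; congr (_ *: _).
(* The predecessor truncates at k = 0, where the factor k is zero. *)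
by case: (val k) => [|j]; rewrite ?mul0r ?mulr0 // exprS; ring.
Qed.

Lemma theta_shift_mxsum c m C :
  theta_shift c (mxsum m C) = mxsum m (fun k => (k%:R + c) *: C k).
Proof.
apply/funext => z; rewrite /theta_shift theta_mxsum /mxsum scaler_sumr.
rewrite -big_split; apply: eq_bigr => k _ /=.
by rewrite !scalerA -scalerDl; congr (_ *: _); ring.
Qed.

Lemma theta_poch_mxsum c j m C :
  theta_poch c j (mxsum m C) =
  mxsum m (fun k => (\prod_(i < j) (k%:R + c + i%:R)) *: C k).
Proof.
elim: j C => [|j IHj] C /=.
  apply/funext => z; apply: eq_bigr => k _.
  by rewrite big_ord0 scale1r.
rewrite theta_shift_mxsum IHj; apply/funext => z; apply: eq_bigr => k _.
by rewrite big_ord_recr addrA -[in RHS]scalerA.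
Qed.

Lemma mulmx_mxsum m C (M : 'M[K]_N) z :
  M *m mxsum m C z = mxsum m (fun k => M *m C k) z.
Proof. by rewrite mulmx_sumr; apply: eq_bigr => k _; rewrite scalemxAr. Qed.

Lemma mxsumD m C1 C2 z :
  mxsum m C1 z + mxsum m C2 z = mxsum m (fun k => C1 k + C2 k) z.
Proof.
by rewrite -big_split; apply: eq_bigr => k _; rewrite scalerDr.
Qed.

End EulerOperator.

Section BatemanCoefficients.
Variables (K : numFieldType) (N : nat).
Implicit Types (A B M : 'M[K]_N) (n k : nat).

Lemma invmx_mulmx M1 M2 : M1 \in unitmx -> M2 \in unitmx ->
  invmx (M1 *m M2) = invmx M2 *m invmx M1.
Proof.
move=> u1 u2; have u12 : M1 *m M2 \in unitmx by rewrite unitmx_mul u1.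
apply: (can_inj (mulKmx u12)).
by rewrite mulmxV // mulmxA mulmxK // mulmxV.
Qed.

Lemma comm_mx_invmx M1 M2 : comm_mx M1 M2 -> comm_mx M1 (invmx M2).
Proof.
have [u2|/invmx_out ->//] := boolP (M2 \in unitmx).
rewrite /comm_mx => c12; apply: (can_inj (mulKmx u2)).
by rewrite mulmxA -c12 mulmxK // mulKVmx.
Qed.

Lemma mx_pochS M k :
  mx_poch (M + 1%:M) k.+1 = mx_poch (M + 1%:M) k *m (M + k.+1%:R%:M).
Proof.
rewrite /mx_poch big_ord_recr; congr (_ *m _) => /=.
by rewrite -[k.+1]add1n natrD raddfD addrA.
Qed.

Lemma mx_poch_unit M k : (forall s : nat, M + s%:R%:M \in unitmx) ->
  mx_poch (M + 1%:M) k \in unitmx.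
Proof.
move=> uM; elim: k => [|k IHk]; first by rewrite /mx_poch big_ord0 unitmx1.
by rewrite mx_pochS unitmx_mul IHk uM.
Qed.

Lemma comm_mx_poch M1 M2 k : comm_mx M1 M2 -> comm_mx M1 (mx_poch M2 k).
Proof.
move=> c12; apply: big_ind => [|X Y|i _]; first exact: comm_mx1.
  exact: comm_mxM.
by apply: comm_mxD => //; apply: comm_mx_scalar.
Qed.

Definition bateman_coef A B n k : 'M[K]_N :=
  ((-1) ^+ k * n`!%:R / (k`!%:R * (n - k)`!%:R)) *:
    (invmx (mx_poch (A + 1%:M) k) *m invmx (mx_poch (B + 1%:M) k)).

Lemma bateman_mxsum A B n : bateman A B n = mxsum K N n.+1 (bateman_coef A B n).
Proof.
apply/funext => z; apply: eq_bigr => k _; rewrite scalerA; congr (_ *: _).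
by ring.
Qed.

(** Write [P_k] for the product [(A + 1) ... (A + k)].  Its last factor is inverted
first: [P_(k+1)^-1 = (A + k + 1)^-1 P_k^-1], and likewise for [B].  So the factor
[A + k + 1] cancels at once; [B + k + 1] must travel through [P_k^-1], which it
commutes with because [B] commutes with [A]. *)
Lemma invmx_poch_rec A B k : comm_mx A B ->
  (forall s : nat, A + s%:R%:M \in unitmx) ->
  (forall s : nat, B + s%:R%:M \in unitmx) ->
  (A + k.+1%:R%:M) *m (B + k.+1%:R%:M) *m
    (invmx (mx_poch (A + 1%:M) k.+1) *m invmx (mx_poch (B + 1%:M) k.+1)) =
  invmx (mx_poch (A + 1%:M) k) *m invmx (mx_poch (B + 1%:M) k).
Proof.
move=> cAB uA uB.
have cBA c : comm_mx (B + c%:M) A.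
  apply/comm_mx_sym; apply: comm_mxD => //; exact: comm_mx_scalar.
rewrite !mx_pochS !invmx_mulmx ?mx_poch_unit //.
set a := A + k.+1%:R%:M; set b := B + k.+1%:R%:M.
set P := invmx (mx_poch _ k); set Q := invmx (mx_poch _ k).
have cba : a *m b = b *m a.
  by symmetry; apply: comm_mxD; [exact: cBA | exact: comm_mx_scalar].
have cbP : b *m P = P *m b.
  apply: comm_mx_invmx; apply: comm_mx_poch.
  by apply: comm_mxD; [exact: cBA | exact: comm_mx_scalar].
by rewrite cba -!mulmxA mulKVmx ?uA // (mulmxA b P) cbP -mulmxA mulKVmx ?uB.
Qed.

Lemma bateman_coef_rec A B n k : comm_mx A B ->
  (forall s : nat, A + s%:R%:M \in unitmx) ->
  (forall s : nat, B + s%:R%:M \in unitmx) -> (k < n)%N ->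
  k.+1%:R *: ((A + k.+1%:R%:M) *m (B + k.+1%:R%:M)) *m bateman_coef A B n k.+1 =
  (k%:R - n%:R) *: bateman_coef A B n k.
Proof.
move=> cAB uA uB ltkn.
rewrite -scalemxAl -scalemxAr invmx_poch_rec // !scalerA; congr (_ *: _).
(* Writing n as k + (n - k - 1) + 1 removes the truncated subtractions, so that
   the identity becomes one in a field. *)
have nk : (n - k)%N = (n - k.+1).+1 by rewrite subnSK.
have En : n%:R = k%:R + (n - k.+1)%:R + 1 :> K.
  by rewrite -natrD natr1 -addnS -nk subnKC // ltnW.
rewrite nk !factS !natrM En exprS -!natr1.
have fact_neq0 j : j`!%:R != 0 :> K by rewrite pnatr_eq0 -lt0n fact_gt0.
by field; rewrite !natr1 !fact_neq0 !pnatr_eq0.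
Qed.

End BatemanCoefficients.

(** The left-hand side is [(x + n) (x + n + A) (x + n + B)] at [x = k - n],
expanded in the rising factorials of [x].  Since [A] stands to the left of [B]
everywhere, both sides are combinations of [A], [B], [A *m B] and the identity,
and can be compared entry by entry with [A *m B] as an opaque matrix. *)
Lemma shifted_symbolE (K : comNzRingType) (N : nat) (A B : 'M[K]_N) (n k : K) :
  n *: ((A + n%:M) *m (B + n%:M))
  + (k - n) *: ((3 * n ^+ 2 - 3 * n + 1)%:M + (2 * n - 1) *: (A + B) + A *m B)
  + ((k - n) * (k - n + 1)) *: (A + B + (3 * n - 3)%:M)
  + ((k - n) * (k - n + 1) * (k - n + 2))%:M
  = k *: ((A + k%:M) *m (B + k%:M)).
Proof.
rewrite !mulmxDl !mulmxDr !mul_scalar_mx !mul_mx_scalar.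
move: (A *m B) => AB; apply/matrixP => i j; rewrite !mxE.
by case: (i == j); rewrite ?mulr1n ?mulr0n; ring.
Qed.

Lemma bateman_ode (K : numFieldType) (N : nat) (A B : 'M[K]_N) (n : nat) (z : K) :
  comm_mx A B ->
  (forall s : nat, A + s%:R%:M \in unitmx) ->
  (forall s : nat, B + s%:R%:M \in unitmx) ->
  n%:R *: ((A + n%:R%:M) *m (B + n%:R%:M)) *m bateman A B n z
  + ((3 * n%:R ^+ 2 - 3 * n%:R + 1)%:M + (2 * n%:R - 1) *: (A + B)
      + A *m B - z%:M) *m theta_poch (- n%:R) 1 (bateman A B n) z
  + (A + B + (3 * n%:R - 3)%:M) *m theta_poch (- n%:R) 2 (bateman A B n) z
  + theta_poch (- n%:R) 3 (bateman A B n) z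
  = 0.
Proof.
move=> cAB uA uB; rewrite bateman_mxsum !theta_poch_mxsum.
set C := bateman_coef K N A B n.
rewrite mulmxBl mul_scalar_mx !mulmx_mxsum.
rewrite [_ + (_ - z *: _)]addrA [_ - _ + _]addrAC [_ - _ + _]addrAC !mxsumD.
apply/eqP; rewrite subr_eq0; apply/eqP.
transitivity (mxsum K N n.+1
    (fun k => k%:R *: ((A + k%:R%:M) *m (B + k%:R%:M)) *m C k) z).
  apply: eq_bigr => k _; congr (_ *: _).
  rewrite -(shifted_symbolE _ _ A B n%:R k%:R); move: (C k) => Ck.
  rewrite [RHS]mulmxDl [X in _ = X + _]mulmxDl [X in _ = X + _ + _]mulmxDl.
  rewrite mul_scalar_mx -!scalemxAr -!scalemxAl !big_ord_recr !big_ord0 /=.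
  by rewrite !mul1r addr0.
(* Dropping the term k = 0 on the left and k = n on the right aligns the two
   sums by degree. *)
rewrite /mxsum big_ord_recl big_ord_recr /=.
rewrite scale0r mul0mx scaler0 add0r big_ord1 addr0 subrr scale0r scaler0 addr0.
rewrite scaler_sumr; apply: eq_bigr => k _.
rewrite /bump /= add1n bateman_coef_rec // big_ord1 addr0 !scalerA.
by rewrite exprS mulrA.
Qed.

Theorem theorem4p8 (R : realType) (N : nat) (A B : 'M[R[i]]_N)
    (commAB : A *m B = B *m A)
    (unitA : forall s : nat, A + s%:R%:M \in unitmx)
    (unitB : forall s : nat, B + s%:R%:M \in unitmx)
    (n : nat) (z : R[i]) :
  n%:R *: ((A + n%:R%:M) *m (B + n%:R%:M)) *m bateman A B n z
  + ((3 * n%:R ^+ 2 - 3 * n%:R + 1)%:M + (2 * n%:R - 1) *: (A + B)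
      + A *m B - z%:M) *m theta_poch (- n%:R) 1 (bateman A B n) z
  + (A + B + (3 * n%:R - 3)%:M) *m theta_poch (- n%:R) 2 (bateman A B n) z
  + theta_poch (- n%:R) 3 (bateman A B n) z
  = 0.
Proof. exact: bateman_ode. Qed.
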